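(* Let $(\mathcal{F},\partial,\oint)$ be a differential Rota-Baxter algebra of weight $\lambda$ over $\mathbf{k}$ and let $(\tilde{\mathcal{F}},\partial,\int)$ be the associated integro-differential algebra $\tilde{\mathcal{F}}=\mathcal{F}\otimes_K\mathcal{F}$, with $\iota\colon\mathcal{F}\to\tilde{\mathcal{F}}$, $f\mapsto f\otimes1$. Then $\tilde{\mathcal{F}}$ is free over $\mathcal{F}$; in other words, any morphism of differential Rota-Baxter algebras $\phi\colon\mathcal{F}\to\mathcal{G}$ to an integro-differential algebra $\mathcal{G}$ of weight $\lambda$ factors as $\phi=\tilde\phi\circ\iota$ for a unique morphism of integro-differential algebras $\tilde\phi\colon\tilde{\mathcal{F}}\to\mathcal{G}$.
   Context: $\mathbf{k}$ is a commutative ring and $\lambda\in\mathbf{k}$; all algebras are commutative unital $\mathbf{k}$-algebras and operators are $\mathbf{k}$-linear. Laws (for all $f,g$, with $f'=\partial f$): - Differential Rota-Baxter algebra of weight $\lambda$ $(\mathcal{F},\partial,\oint)$: $\partial(fg)=f'g+fg'+\lambda f'g'$; $(\oint f)(\oint g)=\oint(f\oint g)+\oint(g\oint f)+\lambda\oint(fg)$; $\partial\oint f=f$. - Integro-differential algebra of weight $\lambda$ $(\mathcal{G},\partial,\int)$: $\partial(fg)=f'g+fg'+\lambda f'g'$; $f\int g=\int(f'\int g)+\int(fg)+\lambda\int(f'g)$; $\partial\int f=f$. Every such algebra is also a differential Rota-Baxter algebra of weight $\lambda$. Morphisms are unital $\mathbf{k}$-algebra homomorphisms commuting with both operators (derivation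 and integral). Construction of $\tilde{\mathcal{F}}$: put $K=\ker\partial\subseteq\mathcal{F}$ and $\tilde{\mathcal{F}}=\mathcal{F}\otimes_K\mathcal{F}$ with derivation $\partial(f\otimes f_\epsilon)=(\partial f)\otimes f_\epsilon$ and integral $\int(f\otimes f_\epsilon)=(\oint f)\otimes f_\epsilon-1\otimes(f_\epsilon\oint f)$. This is an integro-differential algebra of weight $\lambda$. The map $\iota$ is a morphism of differential algebras, but is not required to commute with the integrals ($\int$ is not an extension of $\oint$).
   Formalization: Derivations are required to satisfy ∂(1)=0 (so that K=ker ∂ is a unital subring); the listed laws do not imply this, and the claim fails for k=F=G=ℚ, λ=1, ∂=∮=−id, φ=id. Algebras are taken to be nonzero, which excludes only trivial cases. *)

(* Defs.v *)
From HB Require Import structures.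
From mathcomp Require Import all_boot all_algebra.
From mathcomp Require Import boolp ring.

Set Implicit Arguments.
Unset Strict Implicit.
Unset Printing Implicit Defensive.

Import GRing.Theory.
Local Open Scope ring_scope.
Local Open Scope quotient_scope.

(* Algebras are comAlgType, hence nonzero. The zero algebra, as source or as  *)
(* target, would only add trivial instances.                                  *)
(*                                                                            *)
(* The law der 1 = 0 is part of the usual definition of a differential        *)
(* algebra of weight lambda; it makes ker der a unital subalgebra.            *)
(* It does not follow from the Leibniz rule: with lambda invertible,          *)
(* der f = - lambda^-1 *: f satisfies the latter, and together with           *)
(* integ f = - lambda *: f it satisfies all the other laws below.             *)

HB.mixin Record isDifferential (k : comPzRingType) (lambda : k) A
    of GRing.ComAlgebra k A := {
  der : A -> A;
  der_is_linear : linear der;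
  der1 : der 1 = 0;
  derM : forall f g : A,
    der (f * g) = der f * g + f * der g + lambda *: (der f * der g)
}.

#[short(type="differentialAlgType")]
HB.structure Definition Differential (k : comPzRingType) (lambda : k) :=
  {A of GRing.ComAlgebra k A & isDifferential k lambda A}.

HB.mixin Record hasIntegral (k : comPzRingType) (lambda : k) A
    of Differential k lambda A := {
  integ : A -> A;
  integ_is_linear : linear integ;
  integK : forall f : A, der (integ f) = f
}.

#[short(type="diffIntegralAlgType")]
HB.structure Definition DiffIntegral (k : comPzRingType) (lambda : k) :=
  {A of Differential k lambda A & hasIntegral k lambda A}.

HB.mixin Record isRotaBaxter (k : comPzRingType) (lambda : k) A
    of DiffIntegral k lambda A := {
  rota_baxter : forall f g : A,
    integ f * integ g =
      integ (f * integ g) + integ (g * integ f) + lambda *: integ (f * g)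
}.

#[short(type="diffRotaBaxterAlgType")]
HB.structure Definition DiffRotaBaxter (k : comPzRingType) (lambda : k) :=
  {A of DiffIntegral k lambda A & isRotaBaxter k lambda A}.

HB.mixin Record isIntegroDifferential (k : comPzRingType) (lambda : k) A
    of DiffIntegral k lambda A := {
  integ_by_parts : forall f g : A,
    f * integ g =
      integ (der f * integ g) + integ (f * g) + lambda *: integ (der f * g)
}.

#[short(type="integroDifferentialAlgType")]
HB.structure Definition IntegroDifferential (k : comPzRingType) (lambda : k) :=
  {A of DiffIntegral k lambda A & isIntegroDifferential k lambda A}.

HB.instance Definition _ (k : comPzRingType) (lambda : k)
    (A : differentialAlgType lambda) :=
  GRing.isLinear.Build k A A _ (@der k lambda A) (@der_is_linear k lambda A).

HB.instance Definition _ (k : comPzRingType) (lambda : k)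
    (A : diffIntegralAlgType lambda) :=
  GRing.isLinear.Build k A A _ (@integ k lambda A)
    (@integ_is_linear k lambda A).

Lemma integro_differential_rota_baxter (k : comPzRingType) (lambda : k)
    (A : integroDifferentialAlgType lambda) (f g : A) :
  integ f * integ g =
    integ (f * integ g) + integ (g * integ f) + lambda *: integ (f * g).
Proof. by rewrite integ_by_parts integK [g * integ f]mulrC. Qed.

Definition algebra_morphism (k : comPzRingType) (A B : comAlgType k)
    (phi : A -> B) : Prop :=
  linear phi /\ monoid_morphism phi.

Definition differential_morphism (k : comPzRingType) (lambda : k)
    (A B : differentialAlgType lambda) (phi : A -> B) : Prop :=
  algebra_morphism phi /\ {morph phi : f / der f >-> der f}.

(* The morphisms of differential Rota-Baxter algebras as well as those of     *)
(* integro-differential algebras.                                             *)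

Definition diff_integral_morphism (k : comPzRingType) (lambda : k)
    (A B : diffIntegralAlgType lambda) (phi : A -> B) : Prop :=
  [/\ algebra_morphism phi,
      {morph phi : f / der f >-> der f}
    & {morph phi : f / integ f >-> integ f}].

(* The tensor product over K of A with itself, for K a subalgebra of A, as a  *)
(* k-algebra; tensor_lift below is its universal property. The sequence       *)
(* [:: (a1, b1); ...; (an, bn)] stands for the sum of the ai (x) bi; negative *)
(* coefficients are not needed since - (a (x) b) = (- a) (x) b.               *)

Section TensorProduct.

Variables (k : comPzRingType) (A : comAlgType k) (K : {pred A}).

Inductive tensor_eq : seq (A * A) -> seq (A * A) -> Prop :=
| teq_refl s : tensor_eq s s
| teq_sym s t : tensor_eq s t -> tensor_eq t s
| teq_trans s t u : tensor_eq s t -> tensor_eq t u -> tensor_eq s u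
| teq_cat s s' t t' :
    tensor_eq s s' -> tensor_eq t t' -> tensor_eq (s ++ t) (s' ++ t')
| teq_catC s t : tensor_eq (s ++ t) (t ++ s)
| teq_0l b : tensor_eq [:: (0, b)] [::]
| teq_0r a : tensor_eq [:: (a, 0)] [::]
| teq_Dl a a' b : tensor_eq [:: (a + a', b)] [:: (a, b); (a', b)]
| teq_Dr a b b' : tensor_eq [:: (a, b + b')] [:: (a, b); (a, b')]
| teq_bal c a b : c \in K -> tensor_eq [:: (a * c, b)] [:: (a, c * b)].

Definition tensor_eqb (s t : seq (A * A)) : bool := `[< tensor_eq s t >].

Lemma tensor_eqb_refl : reflexive tensor_eqb.
Proof. by move=> s; apply/asboolP; apply: teq_refl. Qed.

Lemma tensor_eqb_sym : symmetric tensor_eqb.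
Proof.
by move=> s t; apply/idP/idP => /asboolP H; apply/asboolP; apply: teq_sym.
Qed.

Lemma tensor_eqb_trans : transitive tensor_eqb.
Proof.
move=> t s u /asboolP H1 /asboolP H2; apply/asboolP.
exact: teq_trans H1 H2.
Qed.

Canonical tensor_equiv :=
  EquivRel tensor_eqb tensor_eqb_refl tensor_eqb_sym tensor_eqb_trans.

Definition tensor := {eq_quot tensor_equiv}.

HB.instance Definition _ := Choice.on tensor.
HB.instance Definition _ := EqQuotient.on tensor.

Lemma pi_tensor_eq s t : tensor_eq s t <-> \pi_tensor s = \pi_tensor t.
Proof.
split=> [H | /eqmodP /asboolP //].
by apply/eqmodP/asboolP.
Qed.

Lemma repr_tensor s : tensor_eq (repr (\pi_tensor s)) s.
Proof. by apply/pi_tensor_eq; rewrite reprK. Qed.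

Lemma tensor_pi (x : tensor) : exists s, x = \pi_tensor s.
Proof. by exists (repr x); rewrite reprK. Qed.

Definition tensor_add (x y : tensor) : tensor := \pi_tensor (repr x ++ repr y).
Definition tensor_opp (x : tensor) : tensor :=
  \pi_tensor [seq (- p.1, p.2) | p <- repr x].

Lemma pi_tensor_cat s t :
  \pi_tensor (s ++ t) = tensor_add (\pi_tensor s) (\pi_tensor t).
Proof.
by apply/pi_tensor_eq; apply: teq_cat; apply: teq_sym; apply: repr_tensor.
Qed.

Lemma tensor_addA : associative tensor_add.
Proof.
move=> x y z; have [s ->] := tensor_pi x; have [t ->] := tensor_pi y.
by have [u ->] := tensor_pi z; rewrite -!pi_tensor_cat catA.
Qed.

Lemma tensor_addC : commutative tensor_add.
Proof.
by move=> x y; apply/pi_tensor_eq/teq_catC.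
Qed.

Lemma tensor_add0 : left_id (\pi_tensor [::]) tensor_add.
Proof. by move=> x; have [s ->] := tensor_pi x; rewrite -pi_tensor_cat. Qed.

Lemma tensor_addN : left_inverse (\pi_tensor [::]) tensor_opp tensor_add.
Proof.
move=> x; rewrite -{2}[x]reprK /tensor_opp; elim: (repr x) => [|[a b] s IHs].
  by rewrite tensor_add0.
rewrite map_cons -cat1s -[(a, b) :: s]cat1s !pi_tensor_cat /=.
rewrite -tensor_addA [X in tensor_add _ X]tensor_addC -tensor_addA.
rewrite [X in tensor_add _ (tensor_add _ X)]tensor_addC IHs.
rewrite [X in tensor_add _ X]tensor_addC tensor_add0.
rewrite -pi_tensor_cat /=; apply/pi_tensor_eq.
apply: teq_trans (teq_0l b); rewrite -[in X in tensor_eq _ X](addNr a).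
exact/teq_sym/teq_Dl.
Qed.

HB.instance Definition _ :=
  GRing.isZmodule.Build tensor tensor_addA tensor_addC tensor_add0 tensor_addN.

Definition tens (a b : A) : tensor := \pi_tensor [:: (a, b)].

Local Notation "a *t b" := (tens a b) (at level 40, left associativity).

Lemma tens0l b : 0 *t b = 0. Proof. exact/pi_tensor_eq/teq_0l. Qed.
Lemma tens0r a : a *t 0 = 0. Proof. exact/pi_tensor_eq/teq_0r. Qed.

Lemma tensDl a a' b : (a + a') *t b = a *t b + a' *t b.
Proof.
by rewrite /tens -[RHS]pi_tensor_cat; apply/pi_tensor_eq/teq_Dl.
Qed.

Lemma tensDr a b b' : a *t (b + b') = a *t b + a *t b'.
Proof.
by rewrite /tens -[RHS]pi_tensor_cat; apply/pi_tensor_eq/teq_Dr.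
Qed.

Lemma tens_bal c a b : c \in K -> (a * c) *t b = a *t (c * b).
Proof. by move=> cK; apply/pi_tensor_eq/teq_bal. Qed.

Lemma tensNl a b : (- a) *t b = - (a *t b).
Proof. by apply/eqP; rewrite -subr_eq0 opprK -tensDl addNr tens0l. Qed.

Lemma tensNr a b : a *t (- b) = - (a *t b).
Proof. by apply/eqP; rewrite -subr_eq0 opprK -tensDr addNr tens0r. Qed.

Lemma tensBl a a' b : (a - a') *t b = a *t b - a' *t b.
Proof. by rewrite tensDl tensNl. Qed.

Lemma tensBr a b b' : a *t (b - b') = a *t b - a *t b'.
Proof. by rewrite tensDr tensNr. Qed.

Lemma pi_tensor_sum s : \pi_tensor s = \sum_(p <- s) p.1 *t p.2.
Proof.
elim: s => [|[a b] s IHs]; first by rewrite big_nil.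
by rewrite big_cons -IHs -cat1s pi_tensor_cat.
Qed.

Lemma tensor_ind (P : tensor -> Prop) :
  (forall a b, P (a *t b)) -> (forall x y, P x -> P y -> P (x + y)) ->
  forall x, P x.
Proof.
move=> Pt PD x; have [s ->] := tensor_pi x; rewrite pi_tensor_sum.
by apply: big_ind => //; rewrite -(tens0l 0).
Qed.

Definition balanced (V : zmodType) (h : A -> A -> V) : Prop :=
  [/\ forall a a' b, h (a + a') b = h a b + h a' b,
      forall a b b', h a (b + b') = h a b + h a b'
    & forall c a b, c \in K -> h (a * c) b = h a (c * b)].

Definition tensor_lift (V : zmodType) (h : A -> A -> V) (x : tensor) : V :=
  \sum_(p <- repr x) h p.1 p.2.

Section Lift.

Variables (V : zmodType) (h : A -> A -> V).
Hypothesis hB : balanced h.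

Lemma tensor_eq_sum s t :
  tensor_eq s t -> \sum_(p <- s) h p.1 p.2 = \sum_(p <- t) h p.1 p.2.
Proof.
case: hB => hDl hDr hK; elim=> {s t} //=.
- by move=> s t u _ -> _ ->.
- by move=> s s' t t' _ IHs _ IHt; rewrite !big_cat /= IHs IHt.
- by move=> s t; rewrite !big_cat /= addrC.
- move=> b; rewrite big_seq1 big_nil /=.
  by apply: (addrI (h 0 b)); rewrite -hDl !addr0.
- move=> a; rewrite big_seq1 big_nil /=.
  by apply: (addrI (h a 0)); rewrite -hDr !addr0.
- by move=> a a' b; rewrite !big_cons !big_nil /= !addr0 hDl.
- by move=> a b b'; rewrite !big_cons !big_nil /= !addr0 hDr.
- by move=> c a b cK; rewrite !big_seq1 /= hK.
Qed.

Lemma tensor_lift_tens a b : tensor_lift h (a *t b) = h a b.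
Proof.
rewrite /tensor_lift /tens (tensor_eq_sum (repr_tensor _)).
by rewrite big_seq1.
Qed.

Lemma tensor_liftD x y :
  tensor_lift h (x + y) = tensor_lift h x + tensor_lift h y.
Proof.
rewrite [x + y]/(tensor_add x y) /tensor_lift.
by rewrite (tensor_eq_sum (repr_tensor _)) big_cat.
Qed.

Lemma tensor_lift0 : tensor_lift h 0 = 0.
Proof. by apply: (addrI (tensor_lift h 0)); rewrite -tensor_liftD !addr0. Qed.

Lemma tensor_liftN x : tensor_lift h (- x) = - tensor_lift h x.
Proof.
by apply/eqP; rewrite -subr_eq0 opprK -tensor_liftD addNr tensor_lift0.
Qed.

End Lift.

Lemma tensor_lift_balancedD (V : zmodType) (h h' : A -> A -> V) x :
  tensor_lift (fun a b => h a b + h' a b) x =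
  tensor_lift h x + tensor_lift h' x.
Proof. by rewrite /tensor_lift big_split. Qed.

Definition tensor_mul_tens (a b : A) : tensor -> tensor :=
  tensor_lift (fun c d => (a * c) *t (b * d)).

Lemma tensor_mul_tens_balanced a b :
  balanced (fun c d => (a * c) *t (b * d)).
Proof.
split=> [c c' d|c d d'|e c d eK].
- by rewrite mulrDr tensDl.
- by rewrite mulrDr tensDr.
- by rewrite mulrA (tens_bal _ _ eK) mulrCA.
Qed.

Lemma tensor_mul_balanced y : balanced (fun a b => tensor_mul_tens a b y).
Proof.
have B := tensor_mul_tens_balanced; rewrite /tensor_mul_tens.
split=> [a a' b|a b b'|c a b cK]; rewrite -?tensor_lift_balancedD.
- by apply: eq_bigr => p _; rewrite mulrDl tensDl.
- by apply: eq_bigr => p _; rewrite mulrDl tensDr.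
- by apply: eq_bigr => p _; rewrite mulrAC (tens_bal _ _ cK) mulrA.
Qed.

Definition tensor_mul (x y : tensor) : tensor :=
  tensor_lift (fun a b => tensor_mul_tens a b y) x.

Lemma tensor_mulE a b c d :
  tensor_mul (a *t b) (c *t d) = (a * c) *t (b * d).
Proof.
rewrite /tensor_mul tensor_lift_tens; last exact: tensor_mul_balanced.
by rewrite /tensor_mul_tens tensor_lift_tens //; apply: tensor_mul_tens_balanced.
Qed.

Lemma tensor_mulDl : left_distributive tensor_mul +%R.
Proof. by move=> x y z; apply/tensor_liftD/tensor_mul_balanced. Qed.

Lemma tensor_mulC : commutative tensor_mul.
Proof.
have mulDr a b x y : tensor_mul (a *t b) (x + y) =
    tensor_mul (a *t b) x + tensor_mul (a *t b) y.
  rewrite /tensor_mul !tensor_lift_tens; try exact: tensor_mul_balanced.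
  exact/tensor_liftD/tensor_mul_tens_balanced.
have mulDr' z x y : tensor_mul z (x + y) = tensor_mul z x + tensor_mul z y.
  elim/tensor_ind: z => [a b|u v IHu IHv]; first exact: mulDr.
  by rewrite !tensor_mulDl IHu IHv addrACA.
move=> x y; elim/tensor_ind: x => [a b|x x' IHx IHx']; last first.
  by rewrite tensor_mulDl IHx IHx' mulDr'.
elim/tensor_ind: y => [c d|y y' IHy IHy']; last first.
  by rewrite tensor_mulDl mulDr' IHy IHy'.
by rewrite !tensor_mulE [a * c]mulrC [b * d]mulrC.
Qed.

Lemma tensor_mulDr : right_distributive tensor_mul +%R.
Proof.
by move=> x y z; rewrite ![tensor_mul x _]tensor_mulC tensor_mulDl.
Qed.

Lemma tensor_mulA : associative tensor_mul.
Proof.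
move=> x y z; elim/tensor_ind: x => [a b|x x' IHx IHx']; last first.
  by rewrite !tensor_mulDl IHx IHx'.
elim/tensor_ind: y => [c d|y y' IHy IHy']; last first.
  by rewrite !(tensor_mulDl, tensor_mulDr) IHy IHy'.
elim/tensor_ind: z => [e f|z z' IHz IHz']; last first.
  by rewrite !tensor_mulDr IHz IHz'.
by rewrite !tensor_mulE !mulrA.
Qed.

Lemma tensor_mul1 : left_id (1 *t 1) tensor_mul.
Proof.
elim/tensor_ind=> [a b|x y IHx IHy]; last by rewrite tensor_mulDr IHx IHy.
by rewrite tensor_mulE !mul1r.
Qed.

HB.instance Definition _ := GRing.Zmodule_isComPzRing.Build tensor
  tensor_mulA tensor_mulC tensor_mul1 tensor_mulDl.

Lemma tensM a b c d : (a *t b) * (c *t d) = (a * c) *t (b * d).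
Proof. exact: tensor_mulE. Qed.

Lemma tens11 : 1 *t 1 = 1 :> tensor. Proof. by []. Qed.

Definition tensor_scale (c : k) : tensor -> tensor :=
  tensor_lift (fun a b => (c *: a) *t b).

Lemma tensor_scale_balanced c : balanced (fun a b => (c *: a) *t b).
Proof.
split=> [a a' b|a b b'|e a b eK].
- by rewrite scalerDr tensDl.
- by rewrite tensDr.
- by rewrite scalerAl (tens_bal _ _ eK).
Qed.

Lemma tensor_scaleE c a b : tensor_scale c (a *t b) = (c *: a) *t b.
Proof. exact/tensor_lift_tens/tensor_scale_balanced. Qed.

Lemma tensor_scaleDr : right_distributive tensor_scale +%R.
Proof. by move=> c x y; apply/tensor_liftD/tensor_scale_balanced. Qed.

Lemma tensor_scaleA c d x :
  tensor_scale c (tensor_scale d x) = tensor_scale (c * d) x.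
Proof.
elim/tensor_ind: x => [a b|x y IHx IHy]; last by rewrite !tensor_scaleDr IHx IHy.
by rewrite !tensor_scaleE scalerA.
Qed.

Lemma tensor_scale1 : left_id 1 tensor_scale.
Proof.
elim/tensor_ind=> [a b|x y IHx IHy]; last by rewrite tensor_scaleDr IHx IHy.
by rewrite tensor_scaleE scale1r.
Qed.

Lemma tensor_scaleDl x : {morph tensor_scale^~ x : c d / c + d}.
Proof.
move=> c d; elim/tensor_ind: x => [a b|x y IHx IHy].
  by rewrite !tensor_scaleE scalerDl tensDl.
by rewrite !tensor_scaleDr IHx IHy addrACA.
Qed.

HB.instance Definition _ := GRing.Zmodule_isLmodule.Build k tensor
  tensor_scaleA tensor_scale1 tensor_scaleDr tensor_scaleDl.

Lemma tensZl c a b : (c *: a) *t b = c *: (a *t b).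
Proof. exact/esym/tensor_scaleE. Qed.

Lemma tensor_scalerAl (c : k) (x y : tensor) : c *: (x * y) = (c *: x) * y.
Proof.
elim/tensor_ind: x => [a b|x x' IHx IHx']; last first.
  by rewrite mulrDl !scalerDr IHx IHx' mulrDl.
elim/tensor_ind: y => [d e|y y' IHy IHy']; last first.
  by rewrite !mulrDr scalerDr IHy IHy'.
by rewrite -tensZl !tensM -tensZl scalerAl.
Qed.

Lemma tensor_mult_balanced : balanced (fun a b : A => a * b).
Proof.
by split=> [a a' b|a b b'|c a b _]; [rewrite mulrDl | rewrite mulrDr | rewrite mulrA].
Qed.

Lemma tensor_nonzero : (1 : tensor) != 0.
Proof.
apply/eqP => /(congr1 (tensor_lift (fun a b : A => a * b))).
rewrite (tensor_lift0 tensor_mult_balanced) -tens11.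
rewrite (tensor_lift_tens tensor_mult_balanced) mulr1.
exact/eqP/oner_neq0.
Qed.

HB.instance Definition _ :=
  GRing.PzSemiRing_isNonZero.Build tensor tensor_nonzero.

HB.instance Definition _ :=
  GRing.Lmodule_isLalgebra.Build k tensor tensor_scalerAl.

HB.instance Definition _ := GRing.Lalgebra_isComAlgebra.Build k tensor.

End TensorProduct.

Section FreeIntegroDifferential.

Variables (k : comPzRingType) (lambda : k) (F : diffRotaBaxterAlgType lambda).

Definition constants : {pred F} := [pred f : F | der f == 0].

Lemma constantsE (f : F) : (f \in constants) = (der f == 0).
Proof. by []. Qed.

Lemma derMc (c f : F) : c \in constants -> der (f * c) = der f * c.
Proof. by rewrite constantsE derM => /eqP ->; rewrite !mulr0 scaler0 !addr0. Qed.

Lemma constants_scaler (c : k) (f : F) :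
  f \in constants -> c *: f \in constants.
Proof. by rewrite !constantsE linearZ /= => /eqP ->; rewrite scaler0. Qed.

Lemma constants_scalar (c : k) : c *: (1 : F) \in constants.
Proof. by apply: constants_scaler; rewrite constantsE der1. Qed.

Lemma constants_sub_integ_der (f : F) : f - integ (der f) \in constants.
Proof. by rewrite constantsE linearB /= integK subrr. Qed.

Lemma constants_integM (c f : F) :
  c \in constants -> integ (f * c) - integ f * c \in constants.
Proof.
move=> cK; rewrite constantsE linearB /= derMc // !integK.
by rewrite subrr.
Qed.

Definition free_intdiff := tensor constants.

HB.instance Definition _ := GRing.ComAlgebra.on free_intdiff.

Local Notation "f *t g" :=
  (tens constants f g : free_intdiff) (at level 40, left associativity).

Definition free_iota (f : F) : free_intdiff := f *t 1.

Definition free_der : free_intdiff -> free_intdiff :=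
  tensor_lift (fun f fe => der f *t fe).

Definition free_integ : free_intdiff -> free_intdiff :=
  tensor_lift (fun f fe => integ f *t fe - 1 *t (fe * integ f)).

Lemma tensZr (c : k) (f g : F) : f *t (c *: g) = c *: (f *t g).
Proof.
rewrite -tensZl -[g in LHS]mul1r scalerAl -(tens_bal _ _ (constants_scalar c)).
by rewrite [f * _]mulrC -scalerAl mul1r.
Qed.

Lemma free_der_balanced : balanced constants (fun f fe => der f *t fe).
Proof.
split=> [f f' g|f g g'|c f g cK].
- by rewrite linearD tensDl.
- by rewrite tensDr.
- by rewrite derMc // (tens_bal _ _ cK).
Qed.

Lemma tens_const (c f : F) : c \in constants -> c *t f = 1 *t (c * f).
Proof. by move=> cK; rewrite -tens_bal // mul1r. Qed.

Lemma free_integ_balanced :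
  balanced constants (fun f fe => integ f *t fe - 1 *t (fe * integ f)).
Proof.
split=> [f f' g|f g g'|c f g cK].
- by rewrite linearD tensDl mulrDr tensDr opprD addrACA.
- by rewrite tensDr mulrDl tensDr opprD addrACA.
- rewrite -(tens_bal _ _ cK); set d := integ (f * c) - integ f * c.
  have -> : integ (f * c) = d + integ f * c by rewrite subrK.
  rewrite tensDl tens_const ?constants_integM // mulrDr tensDr.
  rewrite [d * g]mulrC opprD addrACA subrr add0r.
  by rewrite [integ f * c in X in _ - X]mulrC mulrCA mulrA.
Qed.

Lemma free_der_tens f g : free_der (f *t g) = der f *t g.
Proof. exact/tensor_lift_tens/free_der_balanced. Qed.

Lemma free_integ_tens f g :
  free_integ (f *t g) = integ f *t g - 1 *t (g * integ f).
Proof. exact/tensor_lift_tens/free_integ_balanced. Qed.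

Lemma free_derD x y : free_der (x + y) = free_der x + free_der y.
Proof. exact/tensor_liftD/free_der_balanced. Qed.

Lemma free_integD x y : free_integ (x + y) = free_integ x + free_integ y.
Proof. exact/tensor_liftD/free_integ_balanced. Qed.

Lemma free_der_is_linear : linear free_der.
Proof.
move=> c x y; rewrite free_derD; congr (_ + _).
elim/tensor_ind: x => [f g|x x' IHx IHx']; last first.
  by rewrite scalerDr !free_derD IHx IHx' scalerDr.
by rewrite -tensZl !free_der_tens linearZ tensZl.
Qed.

Lemma free_integ_is_linear : linear free_integ.
Proof.
move=> c x y; rewrite free_integD; congr (_ + _).
elim/tensor_ind: x => [f g|x x' IHx IHx']; last first.
  by rewrite scalerDr !free_integD IHx IHx' scalerDr.
rewrite -tensZl !free_integ_tens linearZ tensZl scalerBr.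
by rewrite [g * _]mulrC -scalerAl tensZr [_ * g]mulrC.
Qed.

Lemma free_der1 : free_der 1 = 0.
Proof. by rewrite -tens11 free_der_tens der1 tens0l. Qed.

Lemma free_derM x y : free_der (x * y) =
  free_der x * y + x * free_der y + lambda *: (free_der x * free_der y).
Proof.
elim/tensor_ind: x => [f g|x x' IHx IHx']; last first.
  rewrite mulrDl !free_derD IHx IHx' !mulrDl scalerDr.
  by rewrite [X in _ = X + _]addrACA [RHS]addrACA.
elim/tensor_ind: y => [p q|y y' IHy IHy']; last first.
  rewrite !(mulrDr, free_derD) IHy IHy' scalerDr.
  by rewrite [X in _ = X + _]addrACA [RHS]addrACA.
rewrite tensM !free_der_tens !tensM derM !tensDl -tensZl.
by [].
Qed.

Lemma free_integK x : free_der (free_integ x) = x.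
Proof.
elim/tensor_ind: x => [f g|x y IHx IHy]; last by rewrite free_integD free_derD IHx IHy.
rewrite free_integ_tens free_derD -tensNl !free_der_tens integK.
by rewrite linearN /= der1 oppr0 tens0l addr0.
Qed.

HB.instance Definition _ := isDifferential.Build k lambda free_intdiff
  free_der_is_linear free_der1 free_derM.

HB.instance Definition _ := hasIntegral.Build k lambda free_intdiff
  free_integ_is_linear free_integK.

Lemma der_tens f g : der (f *t g) = der f *t g.
Proof. exact: free_der_tens. Qed.

Lemma integ_tens f g : integ (f *t g) = integ f *t g - 1 *t (g * integ f).
Proof. exact: free_integ_tens. Qed.

Lemma free_integ_const (e g p : F) : e \in constants ->
  integ ((g * e) *t p) = (integ g * e) *t p - 1 *t (p * e * integ g).
Proof.
by move=> eK; rewrite (tens_bal _ _ eK) integ_tens -(tens_bal _ _ eK) [e * p]mulrC.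
Qed.

Lemma free_integ_by_parts (x y : free_intdiff) :
  x * integ y =
    integ (der x * integ y) + integ (x * y) + lambda *: integ (der x * y).
Proof.
elim/tensor_ind: x => [f p|x x' IHx IHx']; last first.
  rewrite mulrDl IHx IHx' linearD !mulrDl !linearD /=.
  by ring.
elim/tensor_ind: y => [g q|y y' IHy IHy']; last first.
  rewrite !(linearD, mulrDr) /= IHy IHy'.
  by ring.
have [e eK fE] : exists2 e, e \in constants & f = integ (der f) + e.
  exists (f - integ (der f)); first exact: constants_sub_integ_der.
  by rewrite addrC subrK.
have dE : der f * integ g + f * g + lambda *: (der f * g) =
    (der f * integ g + g * integ (der f) + lambda *: (der f * g)) + g * e.
  by rewrite [in f * g]fE; ring.
have -> : integ (der (f *t p) * integ (g *t q)) + integ ((f *t p) * (g *t q)) +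
    lambda *: integ (der (f *t p) * (g *t q)) =
    integ ((der f * integ g + f * g + lambda *: (der f * g)) *t (p * q)) -
    integ (der f *t (p * (q * integ g))).
  rewrite der_tens [integ (g *t q)]integ_tens mulrBr !tensM mulr1.
  by rewrite !tensDl tensZl linearB !linearD linearZ /=; ring.
rewrite dE tensDl linearD /= free_integ_const // [in X in X + _ - _]integ_tens.
rewrite !linearD !linearZ /= -rota_baxter [integ (g *t q)]integ_tens.
rewrite [integ (der f *t _)]integ_tens mulrBr !tensM mulr1.
rewrite [in LHS]fE mulrDl !tensDl [e * integ g]mulrC (tens_const _ eK).
have -> : p * (q * integ g) * integ (der f) =
  p * q * (integ (der f) * integ g) by ring.
have -> : e * (p * (q * integ g)) = p * q * e * integ g by ring.
by ring.
Qed.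

HB.instance Definition _ := isIntegroDifferential.Build k lambda free_intdiff
  free_integ_by_parts.

Lemma free_iota_differential_morphism : differential_morphism free_iota.
Proof.
split; last by move=> f; rewrite der_tens.
split; first by move=> c f g; rewrite /free_iota tensDl tensZl.
by split=> [|f g]; rewrite /free_iota ?tensM ?mulr1.
Qed.

End FreeIntegroDifferential.

Arguments free_iota {k lambda F} f.

(* Main.v *)
Require Import Defs.
From mathcomp Require Import all_boot all_algebra.
From mathcomp Require Import boolp.

Set Implicit Arguments.
Unset Strict Implicit.
Unset Printing Implicit Defensive.

Import GRing.Theory.
Local Open Scope ring_scope.

(** Every integro-differential algebra carries the projector E = id - int o der
    onto its constants along the image of the integral, the abstract form of
    evaluation at the base point of the integral. Integration by parts says
    precisely that the image of the integral is an ideal ([initial_mul_integ]),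
    that is, that E is multiplicative ([initialM]); this is what distinguishes
    an integro-differential algebra from a differential Rota-Baxter algebra.

    In the tensor square of F over its constants, the right factor is the
    E-image of the left one: 1 (x) g = E (iota g) ([tens_initial]). So
    f (x) g = iota f * E (iota g). A morphism phit extending phi commutes with
    E, hence is forced to be f (x) g |-> phi f * E (phi g), which gives
    uniqueness. Conversely this formula is balanced over the constants and
    multiplicative because E is multiplicative and fixes constants. It commutes
    with the integrals because constants can be pulled out of the integral of G,
    while the correction term - 1 (x) g (oint f) is sent to
    - E (phi g * int (phi f)) = 0; here it matters that phi sends the integral
    of F to the integral of G. *)

(** Evaluation at the base point of the integral: f - int_a f' = f(a). *)
Definition initial (k : comPzRingType) (lambda : k)
  (A : diffIntegralAlgType lambda) (f : A) : A := f - integ (der f).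

Definition initial_lift (k : comPzRingType) (lambda : k)
    (F : diffRotaBaxterAlgType lambda) (G : integroDifferentialAlgType lambda)
    (phi : F -> G) : free_intdiff F -> G :=
  tensor_lift (fun f g => phi f * initial (phi g)).

Lemma initialD (k : comPzRingType) (lambda : k)
    (A : diffIntegralAlgType lambda) (f g : A) :
  initial (f + g) = initial f + initial g.
Proof. by rewrite /initial !linearD /= addrACA. Qed.

Lemma der_initial (k : comPzRingType) (lambda : k)
    (A : diffIntegralAlgType lambda) (f : A) : der (initial f) = 0.
Proof. by rewrite linearB /= integK subrr. Qed.

Lemma initial_const (k : comPzRingType) (lambda : k)
    (A : diffIntegralAlgType lambda) (c : A) : der c = 0 -> initial c = c.
Proof. by move=> c0; rewrite /initial c0 linear0 subr0. Qed.

Lemma initialK (k : comPzRingType) (lambda : k)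
    (A : diffIntegralAlgType lambda) (f : A) :
  f = initial f + integ (der f).
Proof. by rewrite subrK. Qed.

Lemma der_constM (k : comPzRingType) (lambda : k)
    (A : differentialAlgType lambda) (f c : A) :
  der c = 0 -> der (f * c) = der f * c.
Proof. by move=> c0; rewrite derM c0 !mulr0 scaler0 !addr0. Qed.

Section IntegroDifferentialTarget.

Variables (k : comPzRingType) (lambda : k).
Variable G : integroDifferentialAlgType lambda.
Implicit Types f g c : G.

Lemma integ_constM f c : der c = 0 -> integ (f * c) = integ f * c.
Proof.
move=> c0; rewrite ![_ * c]mulrC integ_by_parts c0 !mul0r linear0 scaler0.
by rewrite add0r addr0.
Qed.

(** The image of the integral is an ideal killed by [initial]: differentiating
    f * integ g by the Leibniz rule and integrating the result is the right-hand
    side of integration by parts. *)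
Lemma initial_mul_integ f g : initial (f * integ g) = 0.
Proof.
apply/eqP; rewrite subr_eq0 derM integK.
by rewrite !linearD linearZ /= -integ_by_parts.
Qed.

(** Only [initial g] contributes to the second factor, and being constant it can
    be pulled out. *)
Lemma initialM f g : initial (f * g) = initial f * initial g.
Proof.
rewrite {1}[g]initialK mulrDr initialD initial_mul_integ addr0.
have g0 := der_initial g.
by rewrite {1}/initial der_constM // integ_constM // -mulrBl.
Qed.

End IntegroDifferentialTarget.

(** The element on the left is a constant for the derivation of the tensor
    square, although g itself need not be one in F. Writing g as
    initial g + integ (der g), the first part moves across the tensor sign, and
    the second appears as the correction term of the integral of der g (x) 1. *)
Lemma tens_initial (k : comPzRingType) (lambda : k)
    (F : diffRotaBaxterAlgType lambda) (g : F) :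
  tens (@constants _ _ F) 1 g = initial (free_iota g) :> free_intdiff F.
Proof.
rewrite /initial /free_iota der_tens integ_tens mul1r opprB addrCA -tensBl.
rewrite (tens_const _ (constants_sub_integ_der g)) mulr1 -tensDr.
by rewrite addrC subrK.
Qed.

Lemma tens_iotaM (k : comPzRingType) (lambda : k)
    (F : diffRotaBaxterAlgType lambda) (f g : F) :
  tens (@constants _ _ F) f g = free_iota f * initial (free_iota g)
    :> free_intdiff F.
Proof. by rewrite -tens_initial /free_iota tensM mulr1 mul1r. Qed.

Lemma additive_of_linear (k : comPzRingType) (A B : lmodType k)
    (phi : A -> B) : linear phi -> {morph phi : x y / x + y}.
Proof. by move=> phiL x y; rewrite -[x]scale1r phiL !scale1r. Qed.

Lemma zero_of_linear (k : comPzRingType) (A B : lmodType k)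
    (phi : A -> B) : linear phi -> phi 0 = 0.
Proof.
move/additive_of_linear=> phiD; apply: (addrI (phi 0)).
by rewrite -phiD !addr0.
Qed.

Lemma morphism_initial (k : comPzRingType) (lambda : k)
    (A B : diffIntegralAlgType lambda) (phi : A -> B) :
  diff_integral_morphism phi -> {morph phi : f / initial f}.
Proof.
case=> [[phiL _] phid phii] f.
rewrite {2}[f]initialK (additive_of_linear phiL (initial f)) initialD.
rewrite [phi (integ _)]phii /initial integK subrr addr0.
by rewrite -phid der_initial (zero_of_linear phiL) linear0 subr0.
Qed.

Section Lift.

Variables (k : comPzRingType) (lambda : k).
Variables (F : diffRotaBaxterAlgType lambda).
Variables (G : integroDifferentialAlgType lambda) (phi : F -> G).
Hypothesis phi_morph : diff_integral_morphism phi.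

Let phiL : linear phi. Proof. by case: phi_morph => -[]. Qed.
Let phi1 : phi 1 = 1. Proof. by case: phi_morph => -[_ []]. Qed.
Let phiM : {morph phi : f g / f * g}. Proof. by case: phi_morph => -[_ []]. Qed.
Let phid : {morph phi : f / der f}. Proof. by case: phi_morph. Qed.
Let phii : {morph phi : f / integ f}. Proof. by case: phi_morph. Qed.
Let phiD := additive_of_linear phiL.

Lemma initial_lift_balanced :
  balanced (@constants _ _ F) (fun f g => phi f * initial (phi g)).
Proof.
split=> [f f' g|f g g'|c f g cK].
- by rewrite phiD mulrDl.
- by rewrite phiD initialD mulrDr.
- have c0 : der (phi c) = 0.
    by move: cK; rewrite constantsE -phid => /eqP ->; apply: zero_of_linear.
  by rewrite !phiM initialM (initial_const c0) mulrA.
Qed.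

Lemma initial_lift_tens f g :
  initial_lift phi (tens (@constants _ _ F) f g) = phi f * initial (phi g).
Proof. exact/tensor_lift_tens/initial_lift_balanced. Qed.

Lemma initial_liftD : {morph initial_lift phi : x y / x + y}.
Proof. by move=> x y; apply/tensor_liftD/initial_lift_balanced. Qed.

Lemma initial_liftN : {morph initial_lift phi : x / - x}.
Proof. by move=> x; apply/tensor_liftN/initial_lift_balanced. Qed.

Lemma initial_lift_iota f : initial_lift phi (free_iota f) = phi f.
Proof. by rewrite initial_lift_tens phi1 initial_const ?der1 ?mulr1. Qed.

Lemma initial_lift_linear : linear (initial_lift phi).
Proof.
move=> c x y; rewrite initial_liftD; congr (_ + _).
elim/tensor_ind: x => [f g|x x' IHx IHx']; last first.
  by rewrite scalerDr !initial_liftD IHx IHx' scalerDr.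
rewrite -tensZl !initial_lift_tens -[c *: f]addr0 phiL.
by rewrite (zero_of_linear phiL) addr0 scalerAl.
Qed.

Lemma initial_liftM : {morph initial_lift phi : x y / x * y}.
Proof.
move=> x y; elim/tensor_ind: x => [f p|x x' IHx IHx']; last first.
  by rewrite mulrDl !initial_liftD IHx IHx' mulrDl.
elim/tensor_ind: y => [g q|y y' IHy IHy']; last first.
  by rewrite mulrDr !initial_liftD IHy IHy' mulrDr.
by rewrite tensM !initial_lift_tens !phiM initialM mulrACA.
Qed.

Lemma initial_lift_der : {morph initial_lift phi : x / der x}.
Proof.
elim/tensor_ind=> [f g|x y IHx IHy]; last first.
  by rewrite linearD /= !initial_liftD IHx IHy linearD.
by rewrite der_tens !initial_lift_tens phid der_constM // der_initial.
Qed.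

Lemma initial_lift_integ : {morph initial_lift phi : x / integ x}.
Proof.
elim/tensor_ind=> [f g|x y IHx IHy]; last first.
  by rewrite linearD /= !initial_liftD IHx IHy linearD.
rewrite integ_tens initial_liftD initial_liftN !initial_lift_tens phiM phii.
by rewrite initial_mul_integ mulr0 subr0 integ_constM // der_initial.
Qed.

Lemma initial_lift_morphism : diff_integral_morphism (initial_lift phi).
Proof.
split; [split; [exact: initial_lift_linear|split] | exact: initial_lift_der
  | exact: initial_lift_integ].
- by rewrite -[LHS]/(initial_lift phi (free_iota 1)) initial_lift_iota.
- exact: initial_liftM.
Qed.

(** F and its [initial] values generate the tensor square, and a morphism
    commutes with [initial]. *)
Lemma initial_lift_unique (phit : free_intdiff F -> G) :
  diff_integral_morphism phit -> phi =1 phit \o free_iota ->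
  initial_lift phi =1 phit.
Proof.
move=> phitM phitE; have phitI := morphism_initial phitM.
case: phitM => [[phitL [_ phitM]] _ _].
elim/tensor_ind=> [f g|x y IHx IHy]; last first.
  by rewrite initial_liftD IHx IHy (additive_of_linear phitL).
by rewrite initial_lift_tens tens_iotaM phitM phitI !phitE.
Qed.

End Lift.

Theorem theorem4p6 (k : comPzRingType) (lambda : k)
    (F : diffRotaBaxterAlgType lambda) (G : integroDifferentialAlgType lambda)
    (phi : F -> G) (phi_morph : diff_integral_morphism phi) :
  exists! phit : free_intdiff F -> G,
    diff_integral_morphism phit /\ phi =1 phit \o free_iota.
Proof.
exists (initial_lift phi); split.
  split; first exact: initial_lift_morphism.
  by move=> f; rewrite /= initial_lift_iota.
by move=> phit [phitM phitE]; apply/funext/initial_lift_unique.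
Qed.
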